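(* Any $Ps$-normal topological space is $CCS$-normal.
   Context: A topological space $X$ is called cellular-compact if for any disjoint (i.e. pairwise disjoint) family $\mathcal{U}$ of non-empty open subsets of $X$ there exists a compact subset $K$ of $X$ such that $K\cap U\neq\emptyset$ for every $U\in\mathcal{U}$. A subset is called cellular-compact if it is cellular-compact in its subspace topology. A space is pseudocompact if every continuous real-valued function on it is bounded. A space $X$ is called $CCS$-normal (resp. $Ps$-normal) if there exist a normal space $Y$ and a bijection $f:X\to Y$ such that $f|_C:C\to f(C)$ is a homeomorphism (subspace topologies) for every cellular-compact (resp. pseudocompact) subspace $C$ of $X$. The map $f$ itself is not assumed continuous. *)

(* Defs.v *)
From HB Require Import structures.
From mathcomp Require Import all_boot all_order all_algebra.
From mathcomp Require Import all_classical reals topology normedtype.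
Import numFieldNormedType.Exports.

Set Implicit Arguments.
Unset Strict Implicit.
Unset Printing Implicit Defensive.

Local Open Scope classical_set_scope.
Local Open Scope ring_scope.

(* The set [C : set X], seen as a type, carries the initial topology of the
   inclusion [C -> X], i.e. the subspace topology.
   No separation axiom is part of [compact] or of [normal_space]. *)

Definition cellular_compact (X : topologicalType) : Prop :=
  forall U : set (set X),
    (forall O, U O -> open O /\ O !=set0) ->
    trivIset U id ->
    exists2 K : set X, compact K & forall O, U O -> K `&` O !=set0.

Definition pseudocompact (R : realType) (X : topologicalType) : Prop :=
  forall f : X -> R, continuous f -> [bounded f x | x in [set: X]].

Definition homeomorphism (X Y : topologicalType) (f : X -> Y) : Prop :=
  exists g : Y -> X,
    [/\ cancel f g, cancel g f, continuous f & continuous g].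

(* [f] with domain and codomain restricted to [C] and [f(C)]. *)
Definition corestr (X Y : topologicalType) (f : X -> Y) (C : set X) :
    set_type C -> set_type (f @` C) :=
  sigLR [fun f in C].

(* The class of subspaces is a parameter: it is instantiated with the
   cellular-compact and with the pseudocompact subspaces. *)
Definition normal_up_to (P : topologicalType -> Prop) (X : topologicalType) :
    Prop :=
  exists (Y : topologicalType) (f : X -> Y),
    [/\ normal_space Y, bijective f &
        forall C : set X, P (set_type C) -> homeomorphism (corestr f (C := C))].

Definition CCS_normal (X : topologicalType) : Prop :=
  normal_up_to cellular_compact X.

Definition Ps_normal (R : realType) (X : topologicalType) : Prop :=
  normal_up_to (pseudocompact R) X.

(* Main.v *)
(** Cellular-compact spaces are pseudocompact.  For continuous [f] and a shift
    [c], the nonempty preimages under [f - c] of the open intervals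
    [(k, k + 1)], [k] an integer, form a cellular family; a compact set meeting
    all of them bounds [f] at each point where [f - c] is not an integer.  The
    shifts [0] and [1/2] together reach every point. *)
Require Import Defs.
From mathcomp Require Import all_boot all_order all_algebra.
From mathcomp Require Import all_classical reals topology normedtype.
From mathcomp Require Import lra.
Import Order.TTheory GRing.Theory Num.Theory numFieldNormedType.Exports.

Lemma cellular_compact_bounded_off_int {R : realType} {X : topologicalType}
    (f : X -> R) (c : R) :
  cellular_compact X -> continuous f ->
  exists M : R, forall (x : X) (k : int),
    (k%:~R < f x - c < k%:~R + 1)%R -> (`|f x| <= M)%R.
Proof.
move=> ccX fcont.
pose O (k : int) := [set x | (k%:~R < f x - c < k%:~R + 1)%R]%classic.
have openO k : open (O k).
  have -> : O k = (f @^-1` `](k%:~R + c)%R, (k%:~R + 1 + c)%R[)%classic.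
    by apply/seteqP; split=> x; rewrite /O /= in_itv /= ltrBrDr ltrBlDr.
  by apply: open_comp => [x _|]; [exact: fcont|exact: interval_open].
(* The index is recovered from any point of [O k] as the floor of [f x - c]. *)
have O_inj k l x : O k x -> O l x -> k = l.
  have floorO m : O m x -> Num.floor (f x - c)%R = m.
    by case/andP=> mx xm; apply: floor_def; rewrite intrD ltW.
  by move=> /floorO <- /floorO.
pose U := [set A | A !=set0 /\ exists k, A = O k]%classic.
have [|A B UA UB [x [Ax Bx]]|K cK KU] := ccX U.
- by move=> A [A0 [k Ak]]; split => //; rewrite Ak.
- case: UA UB Ax Bx => _ [k ->] [_ [l ->]] Ak Bl.
  by rewrite (O_inj _ _ _ Ak Bl).
have /compact_bounded[N [_ fN]] : compact (f @` K).
  by apply: continuous_compact => //; exact: continuous_subspaceT.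
(* [compact_bounded] gives only bounds strictly above [N], hence the first [1]; the second covers
   the distance from [f x] to [f y], both in one open interval of length 1. *)
exists (N + 1 + 1)%R => x k Okx.
have [|y [Ky /andP[ky yk]]] := KU (O k).
  by split; [exists x|exists k].
have : (`|f y| <= N + 1)%R by apply: fN; [rewrite ltrDl|exists y].
by case/andP: Okx => kx xk; rewrite !ler_norml => /andP[? ?]; apply/andP; split; lra.
Qed.

Lemma cellular_compact_pseudocompact {R : realType} {X : topologicalType} :
  cellular_compact X -> pseudocompact R X.
Proof.
move=> ccX f fcont.
have [M0 fM0] := cellular_compact_bounded_off_int f 0%R ccX fcont.
have [M1 fM1] := cellular_compact_bounded_off_int f (2^-1)%R ccX fcont.
exists (Num.max M0 M1); split=> [|M /ltW leM x _]; first exact: num_real.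
apply: le_trans leM; rewrite le_max.
have /andP[] := floor_itv (f x); rewrite le_eqVlt intrD => /predU1P[fx _|lt1 lt2].
(* Here [f x] is an integer, so [f x - 2^-1] is the midpoint of the unit interval ending at [f x],
   which starts at [Num.floor (f x) - 1]. *)
- apply/orP; right; apply: (fM1 x (Num.floor (f x) - 1)%R).
  by rewrite intrD -[in X in (_ < X < _)%R]fx; lra.
- by apply/orP; left; apply: (fM0 x (Num.floor (f x))); rewrite subr0 lt1.
Qed.

Theorem theorem2p4 (R : realType) (X : topologicalType) :
  Ps_normal R X -> CCS_normal X.
Proof.
(* The same [Y] and [f] serve: every cellular-compact subspace is among the pseudocompact ones that
   [hf] covers. *)
case=> Y [f [nY bf hf]]; exists Y, f; split=> // C ccC.
by apply: hf; exact: cellular_compact_pseudocompact.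
Qed.
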